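(* Consider a $\mathcal{C}^1$ system of the form $$\dot x=p_0(x)+p_1(x)y=P(x,y),\qquad \dot y=q_0(x)+q_1(x)y+q_2(x)y^2=Q(x,y),$$ with $p_1(x)\not\equiv0$. For each $s\in\mathbb{R}$ and for each $n\in\mathbb{N}$ it is possible to associate to it an $(n+1)$-parameter family of functions $V_n(x,y;c_0,c_1,\ldots,c_n):=V_n(x,y)$ of the form $$V_n(x,y)=v_0(x)+v_1(x)y+v_2(x)y^2+\cdots+v_n(x)y^n,$$ such that for each one of them the function $$M_{s,n}=\langle\nabla V_n,(P,Q)\rangle+s\,V_n\operatorname{div}(P,Q)$$ is a function only of the $x$-variable.
   Context: Here $\operatorname{div}(P,Q)=\frac{\partial P}{\partial x}+\frac{\partial Q}{\partial y}$, $\langle\cdot,\cdot\rangle$ is the scalar product in $\mathbb{R}^2$, and $c_0,\dots,c_n$ are arbitrary real constants (the parameters of the family).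
   Formalization: The functions V_n, and the claim about M_{s,n}, are asserted only over the x where p_1(x) ≠ 0, since at zeros of p_1 the family need not exist: for P=xy, Q=0, s=1, n=0 one is forced to v_0=c_0/x. *)

(* Defs.v *)
(* Stdlib reals with Coquelicot. *)
From Stdlib Require Import Reals.
From Coquelicot Require Import Coquelicot.
Open Scope R_scope.

Definition partial_x (f : R -> R -> R) (x y : R) : R := Derive (fun t => f t y) x.
Definition partial_y (f : R -> R -> R) (x y : R) : R := Derive (fun t => f x t) y.

(* f is of class C^1 on the strip D x R. *)
Definition C1_on_strip (D : R -> Prop) (f : R -> R -> R) : Prop :=
  forall x y : R, D x ->
    ex_derive (fun t => f t y) x /\ ex_derive (fun t => f x t) y /\
    continuity_2d_pt (partial_x f) x y /\ continuity_2d_pt (partial_y f) x y.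

Definition gradient (f : R -> R -> R) (x y : R) : R * R :=
  (partial_x f x y, partial_y f x y).

Definition divergence (P Q : R -> R -> R) (x y : R) : R :=
  partial_x P x y + partial_y Q x y.

Definition scalar_product (u v : R * R) : R := fst u * fst v + snd u * snd v.

Definition fieldP (p0 p1 : R -> R) (x y : R) : R := p0 x + p1 x * y.

Definition fieldQ (q0 q1 q2 : R -> R) (x y : R) : R :=
  q0 x + q1 x * y + q2 x * y ^ 2.

Definition M_fun (s : R) (P Q V : R -> R -> R) (x y : R) : R :=
  scalar_product (gradient V x y) (P x y, Q x y) + s * V x y * divergence P Q x y.

(* v_0(x) + v_1(x) y + ... + v_n(x) y^n; sum_n has n + 1 terms. *)
Definition poly_in_y (n : nat) (v : nat -> R -> R) (x y : R) : R :=
  sum_n (fun k => v k x * y ^ k) n.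

Definition only_x_on (D : R -> Prop) (f : R -> R -> R) : Prop :=
  exists m : R -> R, forall x y : R, D x -> f x y = m x.

(* The functions V c on D x R form a family with exactly n + 1 parameters
   c 0, ..., c n.  The first clause gives continuity in these parameters, and
   with it independence from c i for i > n.  The second says that no parameter
   is redundant, even over a small piece of D.  Continuity is essential here:
   since R^(n+1) and R are equipotent, injectivity alone would not distinguish
   different numbers of parameters. *)
Definition parameter_family (D : R -> Prop) (n : nat)
    (V : (nat -> R) -> R -> R -> R) : Prop :=
  (forall (c : nat -> R) (x y : R), D x ->
     forall eps : R, 0 < eps -> exists delta : R, 0 < delta /\
       forall c' : nat -> R,
         (forall i : nat, (i <= n)%nat -> Rabs (c' i - c i) < delta) ->
         Rabs (V c' x y - V c x y) < eps) /\
  (forall A : R -> Prop, open A -> (exists x : R, A x) ->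
     (forall x : R, A x -> D x) ->
     forall c c' : nat -> R,
       (forall x y : R, A x -> V c x y = V c' x y) ->
       forall i : nat, (i <= n)%nat -> c i = c' i).

(* The v_k solve linear differential equations with leading coefficient p1, so
   the family lives over the x where p1 does not vanish, and in general it does
   not extend to the zeros of p1: for x' = x y, y' = 0, s = 1, n = 0 the
   condition is x v_0' + v_0 = 0, that is, v_0 = c_0 / x. *)
Definition nonvanishing (D : R -> Prop) (p1 : R -> R) (x : R) : Prop :=
  D x /\ p1 x <> 0.

(* Main.v *)
(* In M_{s,n} the coefficient of y^(k+1) is a first-order linear differential
   expression in v_k, with leading coefficient p_1, plus terms involving only
   v_(k+1) and v_(k+2). Its vanishing can therefore be solved downwards in k by
   quadratures wherever p_1 <> 0. For each j let W_j be the solution of degree j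
   in y whose top coefficient is a nowhere vanishing homogeneous solution. The
   equations being linear, V = c_0 W_0 + ... + c_n W_n is a family as required,
   and the triangular shape of the W_j makes the c_i recoverable from V. *)
Require Import Defs.
From Stdlib Require Import Reals Lra Lia.
From Stdlib Require Import ClassicalEpsilon FunctionalExtensionality PropExtensionality.
From Coquelicot Require Import Coquelicot.
Open Scope R_scope.

(** * Continuity and C^1 regularity over a set of reals *)

Definition continuous_over (E : R -> Prop) (f : R -> R) : Prop :=
  forall x : R, E x -> continuous f x.

Definition C1_over (E : R -> Prop) (f : R -> R) : Prop :=
  forall x : R, E x -> ex_derive f x /\ continuous (Derive f) x.

Lemma continuous_over_plus (E : R -> Prop) (f g : R -> R) :
  continuous_over E f -> continuous_over E g ->
  continuous_over E (fun x => f x + g x).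
Proof.
  intros hf hg x hx.
  exact (continuous_plus f g x (hf x hx) (hg x hx)).
Qed.

Lemma continuous_over_mult (E : R -> Prop) (f g : R -> R) :
  continuous_over E f -> continuous_over E g ->
  continuous_over E (fun x => f x * g x).
Proof.
  intros hf hg x hx.
  exact (continuous_mult f g x (hf x hx) (hg x hx)).
Qed.

Lemma continuous_over_opp (E : R -> Prop) (f : R -> R) :
  continuous_over E f -> continuous_over E (fun x => - f x).
Proof.
  intros hf x hx.
  exact (continuous_opp f x (hf x hx)).
Qed.

Lemma continuous_over_const (E : R -> Prop) (a : R) :
  continuous_over E (fun _ => a).
Proof.
  intros x hx.
  apply continuous_const.
Qed.

Lemma continuous_over_div (E : R -> Prop) (f g : R -> R) :
  continuous_over E f -> continuous_over E g ->
  (forall x : R, E x -> g x <> 0) ->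
  continuous_over E (fun x => f x / g x).
Proof.
  intros hf hg hg0.
  apply continuous_over_mult; [exact hf|].
  intros x hx.
  exact (continuous_Rinv_comp g x (hg x hx) (hg0 x hx)).
Qed.

Lemma ex_derive_continuous_over (E : R -> Prop) (f : R -> R) :
  (forall x : R, E x -> ex_derive f x) -> continuous_over E f.
Proof.
  intros hf x hx.
  exact (ex_derive_continuous f x (hf x hx)).
Qed.

Lemma C1_over_continuous (E : R -> Prop) (f : R -> R) :
  C1_over E f -> continuous_over E f.
Proof.
  intros hf.
  apply ex_derive_continuous_over.
  intros x hx; apply hf, hx.
Qed.

(** * Segments, components and primitives on an open set *)

Definition segment_in (E : R -> Prop) (x y : R) : Prop :=
  forall z : R, Rmin x y <= z <= Rmax x y -> E z.

Lemma segment_in_refl (E : R -> Prop) (x : R) : E x -> segment_in E x x.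
Proof.
  intros hx z.
  rewrite Rmin_left, Rmax_left by lra.
  intros hz; now replace z with x by lra.
Qed.

Lemma segment_in_sym (E : R -> Prop) (x y : R) :
  segment_in E x y -> segment_in E y x.
Proof.
  intros h z hz.
  apply h.
  now rewrite Rmin_comm, Rmax_comm.
Qed.

(** A point between [x] and [z] lies between [x] and [y] or between [y] and [z], whatever the order
    of the three. *)
Lemma segment_in_trans (E : R -> Prop) (x y z : R) :
  segment_in E x y -> segment_in E y z -> segment_in E x z.
Proof.
  intros hxy hyz t.
  specialize (hxy t); specialize (hyz t); revert hxy hyz.
  unfold Rmin, Rmax.
  destruct (Rle_dec x y), (Rle_dec y z), (Rle_dec x z);
    intros hxy hyz ht; destruct (Rle_dec t y);
    first [apply hxy; lra | apply hyz; lra].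
Qed.

(** A ball on the line is an interval, so it contains the segment from its centre to each of its
    points. *)
Lemma open_locally_segment_in (E : R -> Prop) (x : R) :
  open E -> E x -> locally x (segment_in E x).
Proof.
  intros hE hx.
  destruct (hE x hx) as [d hd].
  exists d; intros y hy z hz.
  apply hd.
  revert hy hz.
  unfold ball; simpl; unfold AbsRing_ball, abs, minus, plus, opp; simpl.
  unfold Rmin, Rmax.
  destruct (Rle_dec x y); intros hy hz; apply Rabs_def1; apply Rabs_def2 in hy; lra.
Qed.

(** For [x] in [E], a representative of the component of [x]. Since [epsilon] sees only the
    predicate, the choice can be made the same throughout a component. *)
Definition base_point (E : R -> Prop) (x : R) : R :=
  epsilon (inhabits 0) (segment_in E x).

Lemma base_point_spec (E : R -> Prop) (x : R) :
  E x -> segment_in E x (base_point E x).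
Proof.
  intros hx.
  unfold base_point; apply epsilon_spec.
  exists x; now apply segment_in_refl.
Qed.

(** Two points of one component define equivalent predicates [segment_in E _]. Extensionality makes
    these equal, and then [epsilon] returns the same point. *)
Lemma base_point_component (E : R -> Prop) (x y : R) :
  segment_in E x y -> base_point E x = base_point E y.
Proof.
  intros hxy.
  unfold base_point; f_equal.
  apply functional_extensionality; intros z.
  apply propositional_extensionality; split; intros h.
  - exact (segment_in_trans E y x z (segment_in_sym E x y hxy) h).
  - exact (segment_in_trans E x y z hxy h).
Qed.

(* E may have infinitely many components: the integral starts from a point
   chosen once and for all in the component of x. *)
Lemma primitive_exists (E : R -> Prop) (f : R -> R) :
  open E -> continuous_over E f ->
  exists F : R -> R, forall x : R, E x -> is_derive F x (f x).
Proof.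
  intros hE hf.
  exists (fun x => RInt f (base_point E x) x).
  intros x hx.
  (* Near [x] the base point does not move, so the lower bound can be frozen before the integral is
     differentiated. *)
  apply is_derive_ext_loc with (fun y => RInt f (base_point E x) y).
  - generalize (open_locally_segment_in E x hE hx); apply filter_imp.
    intros y hy.
    now rewrite (base_point_component E x y hy).
  - apply (is_derive_RInt f _ (base_point E x)); [|now apply hf].
    generalize (open_locally_segment_in E x hE hx); apply filter_imp.
    intros y hy.
    apply (RInt_correct f), (ex_RInt_continuous f).
    intros z hz.
    apply hf.
    refine (segment_in_trans E (base_point E x) x y _ hy z hz).
    apply segment_in_sym, base_point_spec, hx.
Qed.

(** Openness of [E] makes [Derive f] agree with [df] on a whole neighbourhood of each point, which
    is what transferring continuity requires. *)
Lemma C1_over_of_is_derive (E : R -> Prop) (f df : R -> R) :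
  open E -> (forall x : R, E x -> is_derive f x (df x)) ->
  continuous_over E df -> C1_over E f.
Proof.
  intros hE hf hdf x hx; split.
  - exists (df x); now apply hf.
  - apply continuous_ext_loc with df; [|now apply hdf].
    generalize (hE x hx); apply filter_imp.
    intros y hy; symmetry.
    now apply is_derive_unique, hf.
Qed.

(** * First-order linear differential equations and the descending recursion *)

Lemma homogeneous_linear_ode (E : R -> Prop) (a : R -> R) :
  open E -> continuous_over E a ->
  exists h : R -> R, (forall x : R, h x <> 0) /\
    forall x : R, E x -> is_derive h x (a x * h x).
Proof.
  intros hE ha.
  destruct (primitive_exists E a hE ha) as [F hF].
  (* The exponential of a primitive of [a] vanishes nowhere, not even outside [E]. *)
  exists (fun x => exp (F x)); split.
  - intros x; generalize (exp_pos (F x)); lra.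
  - intros x hx.
    apply (is_derive_comp exp F x (exp (F x)) (a x)); [|now apply hF].
    apply is_derive_Reals, derivable_pt_lim_exp.
Qed.

(** Variation of constants: with [h] a homogeneous solution, [h * G] solves the equation once G' = g
    / h. *)
Lemma linear_ode (E : R -> Prop) (a g : R -> R) :
  open E -> continuous_over E a -> continuous_over E g ->
  exists v : R -> R, forall x : R, E x -> is_derive v x (a x * v x + g x).
Proof.
  intros hE ha hg.
  destruct (homogeneous_linear_ode E a hE ha) as [h [hh0 hh]].
  destruct (primitive_exists E (fun x => g x / h x) hE) as [G hG].
  { apply continuous_over_div; auto.
    apply ex_derive_continuous_over.
    intros x hx; exists (a x * h x); auto. }
  exists (fun x => h x * G x); intros x hx.
  evar_last.
  - apply (is_derive_mult h G x (a x * h x) (g x / h x)); auto.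
    intros; apply Rmult_comm.
  - unfold plus, mult; simpl.
    field; auto.
Qed.

(* Coefficients of the solution starting with the homogeneous solution in
   position j; the equations are solved for k = j, j - 1, ..., 0. *)
Lemma ladder_solution (E : R -> Prop) (p0 p1 : R -> R)
  (al be ga : nat -> R -> R) (j : nat) :
  open E ->
  continuous_over E p0 -> continuous_over E p1 ->
  (forall x : R, E x -> p1 x <> 0) ->
  (forall k : nat, continuous_over E (al k)) ->
  (forall k : nat, continuous_over E (be k)) ->
  (forall k : nat, continuous_over E (ga k)) ->
  exists w : nat -> R -> R,
    (forall k : nat, C1_over E (w k)) /\
    (forall (k : nat) (x : R), (j < k)%nat -> w k x = 0) /\
    (forall x : R, w j x <> 0) /\
    (forall (k : nat) (x : R), E x ->
       p1 x * Derive (w k) x + al k x * w k x + p0 x * Derive (w (S k)) x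
       + be k x * w (S k) x + ga k x * w (S (S k)) x = 0).
Proof.
  intros hE hp0 hp1 hp1n hal hbe hga.
  assert (C0 : C1_over E (fun _ => 0)).
  { apply (C1_over_of_is_derive E _ (fun _ => 0) hE).
    - intros x hx; exact (is_derive_const 0 x).
    - apply continuous_over_const. }
  (* Induction on the number [m] of equations solved below the one of index [j]: at this stage those
     of index at least [i = j - m] hold. *)
  assert (H : forall m i : nat, (i + m = j)%nat ->
    exists w : nat -> R -> R,
    (forall k : nat, C1_over E (w k)) /\
    (forall (k : nat) (x : R), (j < k)%nat -> w k x = 0) /\
    (forall x : R, w j x <> 0) /\
    (forall (k : nat) (x : R), (i <= k)%nat -> E x ->
       p1 x * Derive (w k) x + al k x * w k x + p0 x * Derive (w (S k)) x
       + be k x * w (S k) x + ga k x * w (S (S k)) x = 0)).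
  2: { destruct (H j 0%nat (eq_refl _)) as [w [h1 [h2 [h3 h4]]]].
       exists w; repeat split; auto with arith; try apply h1; auto. }
  induction m as [|m IH]; intros i hi.
  - assert (i = j) by lia; subst i; clear hi.
    destruct (homogeneous_linear_ode E (fun x => - (al j x / p1 x)) hE) as [h [hh0 hh]].
    { apply continuous_over_opp, continuous_over_div; auto. }
    (* Only position [j] is occupied, so equation [j] reduces to p1 h' + al_j h = 0 and the later
       ones are trivial. *)
    exists (fun k => if Nat.eq_dec k j then h else fun _ => 0).
    split; [|split; [|split]].
    + intros k; destruct (Nat.eq_dec k j); [|exact C0].
      apply (C1_over_of_is_derive E _ _ hE hh), continuous_over_mult.
      * apply continuous_over_opp, continuous_over_div; auto.
      * apply ex_derive_continuous_over; intros x hx; eexists; now apply hh.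
    + intros k x hk; destruct (Nat.eq_dec k j); [lia|reflexivity].
    + intros x; destruct (Nat.eq_dec j j); [apply hh0|lia].
    + intros k x hk hx.
      destruct (Nat.eq_dec (S k) j); [lia|].
      destruct (Nat.eq_dec (S (S k)) j); [lia|].
      rewrite Derive_const.
      destruct (Nat.eq_dec k j) as [->|].
      * rewrite (is_derive_unique _ _ _ (hh x hx)).
        field; auto.
      * rewrite Derive_const; ring.
  - destruct (IH (S i)) as [w [h1 [h2 [h3 h4]]]]; [lia|].
    (* Divided by [p1], equation [i] reads u' = a u + g, where [g] involves only the known
       coefficients of index i + 1 and i + 2. *)
    set (a := fun x => - (al i x / p1 x)).
    set (g := fun x => - ((p0 x * Derive (w (S i)) x
       + be i x * w (S i) x + ga i x * w (S (S i)) x) / p1 x)).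
    assert (ha : continuous_over E a).
    { apply continuous_over_opp, continuous_over_div; auto. }
    assert (hg : continuous_over E g).
    { apply continuous_over_opp, continuous_over_div; auto.
      repeat apply continuous_over_plus; apply continuous_over_mult; auto using C1_over_continuous.
      intros x hx; now apply h1. }
    destruct (linear_ode E a g hE ha hg) as [u hu].
    (* The equations of index above [i] involve only positions above [i], so they survive this
       change. *)
    exists (fun k => if Nat.eq_dec k i then u else w k).
    split; [|split; [|split]].
    + intros k; destruct (Nat.eq_dec k i); [|auto].
      apply (C1_over_of_is_derive E _ _ hE hu).
      apply continuous_over_plus; auto; apply continuous_over_mult; auto.
      apply ex_derive_continuous_over; intros x hx; eexists; now apply hu.
    + intros k x hk; destruct (Nat.eq_dec k i); [lia|auto].
    + intros x; destruct (Nat.eq_dec j i); [lia|auto].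
    + intros k x hk hx.
      destruct (Nat.eq_dec (S k) i); [lia|].
      destruct (Nat.eq_dec (S (S k)) i); [lia|].
      destruct (Nat.eq_dec k i) as [->|].
      * rewrite (is_derive_unique _ _ _ (hu x hx)).
        unfold a, g.
        field; auto.
      * apply h4; auto; lia.
Qed.

(** * Polynomials in y with coefficients depending on x *)

Lemma sum_n_R_S (f : nat -> R) (n : nat) :
  sum_n f (S n) = sum_n f n + f (S n) :> R.
Proof.
  exact (sum_Sn f n).
Qed.

Lemma is_derive_poly_in_y_x (n : nat) (v : nat -> R -> R) (x y : R) :
  (forall k : nat, ex_derive (v k) x) ->
  is_derive (fun t => poly_in_y n v t y) x
    (poly_in_y n (fun k => Derive (v k)) x y).
Proof.
  intros hv.
  apply (is_derive_sum_n (fun k t => v k t * y ^ k)).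
  intros k _.
  apply (is_derive_scal_l (v k) x (Derive (v k) x) (y ^ k)).
  now apply Derive_correct.
Qed.

(** At [k = 0] the value of [pred k] is immaterial, because the factor [INR k] is zero. *)
Lemma is_derive_poly_in_y_y (n : nat) (v : nat -> R -> R) (x y : R) :
  is_derive (fun t => poly_in_y n v x t) y
    (sum_n (fun k => v k x * (INR k * y ^ pred k)) n).
Proof.
  apply (is_derive_sum_n (fun k t => v k x * t ^ k)).
  intros k _.
  apply is_derive_scal, is_derive_Reals, derivable_pt_lim_pow.
Qed.

Lemma continuity_2d_pt_sum_n (f : nat -> R -> R -> R) (n : nat) (x y : R) :
  (forall k : nat, continuity_2d_pt (f k) x y) ->
  continuity_2d_pt (fun u v => sum_n (fun k => f k u v) n) x y.
Proof.
  intros hf.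
  induction n as [|n IH].
  - apply continuity_2d_pt_ext with (f 0%nat); auto.
    intros u v; now rewrite sum_O.
  - apply continuity_2d_pt_ext
      with (fun u v => sum_n (fun k => f k u v) n + f (S n) u v).
    + intros u v; now rewrite sum_n_R_S.
    + now apply continuity_2d_pt_plus.
Qed.

Lemma continuity_2d_pt_separable (f g : R -> R) (x y : R) :
  continuous f x -> continuous g y ->
  continuity_2d_pt (fun u v => f u * g v) x y.
Proof.
  intros hf hg.
  apply continuity_2d_pt_mult.
  - apply continuity_1d_2d_pt_comp; [|apply continuity_2d_pt_id1].
    now apply continuity_pt_filterlim.
  - apply continuity_1d_2d_pt_comp; [|apply continuity_2d_pt_id2].
    now apply continuity_pt_filterlim.
Qed.

Lemma continuous_monomial (a : R) (k : nat) (y : R) :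
  continuous (fun t => a * t ^ k) y.
Proof.
  apply (ex_derive_continuous (fun t => a * t ^ k)).
  auto_derive; auto.
Qed.

Lemma poly_in_y_C1 (E : R -> Prop) (n : nat) (v : nat -> R -> R) :
  open E -> (forall k : nat, C1_over E (v k)) ->
  C1_on_strip E (poly_in_y n v).
Proof.
  intros hE hv x y hx.
  repeat split.
  - eexists; apply is_derive_poly_in_y_x; intros k; now apply hv.
  - eexists; apply is_derive_poly_in_y_y.
  (* The formula for the x-derivative is available over [E] only, so the comparison is local; the
     one for the y-derivative below holds everywhere. *)
  - apply continuity_2d_pt_ext_loc with (poly_in_y n (fun k => Derive (v k))).
    + destruct (hE x hx) as [d hd].
      exists d; intros u t hu _.
      symmetry; apply is_derive_unique, is_derive_poly_in_y_x.
      intros k; now apply hv, hd.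
    + apply continuity_2d_pt_sum_n; intros k.
      apply (continuity_2d_pt_separable (Derive (v k)) (fun t => t ^ k)).
      * now apply hv.
      * apply (ex_derive_continuous (fun t => t ^ k)); auto_derive; auto.
  - apply continuity_2d_pt_ext
      with (fun u t => sum_n (fun k => v k u * (INR k * t ^ pred k)) n).
    + intros u t; symmetry; apply is_derive_unique, is_derive_poly_in_y_y.
    + apply continuity_2d_pt_sum_n; intros k.
      apply (continuity_2d_pt_separable (v k) (fun t => INR k * t ^ pred k)).
      * apply (C1_over_continuous E); auto.
      * apply continuous_monomial.
Qed.

(** Induction on [n]: the value at y = 0 kills [a 0], division by y makes the shifted polynomial
    vanish off 0, and its continuity extends this to y = 0. *)
Lemma poly_in_y_zero_coefficients (n : nat) (a : nat -> R) :
  (forall y : R, sum_n (fun k => a k * y ^ k) n = 0) ->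
  forall k : nat, (k <= n)%nat -> a k = 0.
Proof.
  revert a; induction n as [|n IH]; intros a ha.
  - intros k hk; replace k with 0%nat by lia.
    generalize (ha 0); rewrite sum_O; simpl; lra.
  - assert (split_a : forall y, sum_n (fun k => a k * y ^ k) (S n)
        = a 0%nat + y * sum_n (fun k => a (S k) * y ^ k) n).
    { intros y; unfold sum_n; rewrite sum_Sn_m by lia.
      rewrite <- (sum_n_m_S (fun k => a k * y ^ k)).
      unfold plus; simpl.
      rewrite <- (sum_n_m_mult_l (K := R_Ring)); unfold mult; simpl.
      f_equal; [ring|].
      apply sum_n_m_ext; intros k; simpl; ring. }
    assert (h0 : a 0%nat = 0).
    { generalize (ha 0); rewrite split_a; lra. }
    assert (off0 : forall y, y <> 0 -> sum_n (fun k => a (S k) * y ^ k) n = 0).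
    { intros y hy; generalize (ha y); rewrite split_a, h0.
      intros h; apply (Rmult_eq_reg_l y); lra. }
    assert (hq : forall y, sum_n (fun k => a (S k) * y ^ k) n = 0).
    { intros y; destruct (Req_dec y 0) as [->|]; [|auto].
      set (q := fun y => sum_n (fun k => a (S k) * y ^ k) n).
      assert (hc : is_lim q 0 (q 0)).
      { apply is_lim_continuity, continuity_pt_filterlim.
        apply (ex_derive_continuous q).
        eexists; apply (is_derive_poly_in_y_y n (fun k _ => a (S k)) 0). }
      assert (hl : is_lim q 0 0).
      { apply is_lim_ext_loc with (fun _ => 0); [|apply is_lim_const].
        exists (mkposreal 1 Rlt_0_1); intros z _ hz; symmetry; now apply off0. }
      apply is_lim_unique in hc; apply is_lim_unique in hl.
      rewrite hc in hl; now injection hl. }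
    intros [|k] hk; [exact h0|].
    apply (IH (fun k => a (S k)) hq); lia.
Qed.

(** * Linear combinations and their dependence on the parameters *)

Lemma sum_n_single (f : nat -> R) (n i : nat) :
  (i <= n)%nat -> (forall j : nat, (j <= n)%nat -> j <> i -> f j = 0) ->
  sum_n f n = f i :> R.
Proof.
  revert i; induction n as [|n IH]; intros i hi hf.
  - rewrite sum_O; f_equal; lia.
  - rewrite sum_n_R_S.
    destruct (Nat.eq_dec i (S n)) as [->|hne].
    + rewrite (sum_n_ext_loc f (fun _ => 0)).
      * rewrite sum_n_const; ring.
      * intros k hk; apply hf; lia.
    + rewrite (hf (S n)), (IH i); try lia; [ring|].
      intros; apply hf; lia.
Qed.

Lemma Rabs_sum_n_mult_le (e K : nat -> R) (n : nat) (d : R) :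
  (forall i : nat, (i <= n)%nat -> Rabs (e i) <= d) ->
  Rabs (sum_n (fun i => e i * K i) n) <= d * sum_n (fun i => Rabs (K i)) n.
Proof.
  intros he; induction n as [|n IH].
  - rewrite !sum_O, Rabs_mult.
    apply Rmult_le_compat_r; auto using Rabs_pos.
  - rewrite !sum_n_R_S.
    eapply Rle_trans; [apply Rabs_triang|].
    rewrite Rmult_plus_distr_l, Rabs_mult.
    apply Rplus_le_compat.
    + apply IH; auto.
    + apply Rmult_le_compat_r; auto using Rabs_pos.
Qed.

(** Exchanging the two finite sums exhibits the function as c_0 W_0 + ... + c_n W_n, linear in the
    parameters. *)
Lemma poly_in_y_combination (n : nat) (c : nat -> R) (w : nat -> nat -> R -> R)
  (x y : R) :
  poly_in_y n (fun k t => sum_n (fun j => c j * w j k t) n) x y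
  = sum_n (fun j => c j * poly_in_y n (w j) x y) n.
Proof.
  unfold poly_in_y.
  rewrite (sum_n_ext (fun j => c j * sum_n (fun k => w j k x * y ^ k) n)
    (fun j => sum_n (fun k => c j * w j k x * y ^ k) n)).
  - rewrite sum_n_switch.
    apply sum_n_ext; intros k.
    symmetry; exact (sum_n_mult_r (K := R_Ring) (y ^ k) (fun j => c j * w j k x) n).
  - intros j.
    rewrite <- (sum_n_mult_l (K := R_Ring)); unfold mult; simpl.
    apply sum_n_ext; intros k; simpl; ring.
Qed.

Lemma sum_n_minus (f g : nat -> R) (n : nat) :
  sum_n (fun k => f k - g k) n = sum_n f n - sum_n g n :> R.
Proof.
  induction n as [|n IH].
  - now rewrite !sum_O.
  - rewrite !sum_n_R_S, IH; ring.
Qed.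

(** Continuity comes from linearity in finitely many parameters. For injectivity, comparing the
    powers of y at a point of [A] gives a triangular linear system for the differences [c j - c' j],
    with nonzero diagonal. *)
Lemma triangular_parameter_family (D : R -> Prop) (n : nat)
  (w : nat -> nat -> R -> R) :
  (forall (j k : nat) (x : R), (j < k)%nat -> w j k x = 0) ->
  (forall (j : nat) (x : R), D x -> w j j x <> 0) ->
  parameter_family D n
    (fun c => poly_in_y n (fun k x => sum_n (fun j => c j * w j k x) n)).
Proof.
  intros htri hdiag; split.
  - intros c x y hx eps heps.
    pose (B := sum_n (fun j => Rabs (poly_in_y n (w j) x y)) n : R).
    assert (hB : 0 <= B).
    (* Nonnegativity is read off from the bound for a sum with zero coefficients and [d = 1]. *)
    { eapply Rle_trans; [apply Rabs_pos|].
      generalize (Rabs_sum_n_mult_le (fun _ => 0) (fun j => poly_in_y n (w j) x y) n 1).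
      rewrite Rmult_1_l; intros h; apply h.
      intros i _; rewrite Rabs_R0; lra. }
    (* [B + 1] rather than [B] keeps the divisor positive and makes the final inequality strict. *)
    exists (eps / (B + 1)); split.
    + apply Rdiv_lt_0_compat; lra.
    + intros c' hc'.
      rewrite !poly_in_y_combination.
      replace (sum_n _ n - sum_n _ n) with
        (sum_n (fun j => (c' j - c j) * poly_in_y n (w j) x y) n).
      * eapply Rle_lt_trans.
        -- apply Rabs_sum_n_mult_le with (d := eps / (B + 1)).
           intros i hi; left; auto.
        -- change (eps / (B + 1) * B < eps).
           replace eps with (eps / (B + 1) * (B + 1)) at 2 by (field; lra).
           apply Rmult_lt_compat_l; [|lra].
           apply Rdiv_lt_0_compat; lra.
      * rewrite <- sum_n_minus.
        apply sum_n_ext; intros j; simpl; ring.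
  - intros A _ [x0 hx0] hA c c' heq.
    assert (hd : forall k, (k <= n)%nat ->
      sum_n (fun j => (c j - c' j) * w j k x0) n = 0).
    { apply poly_in_y_zero_coefficients; intros y.
      specialize (heq x0 y hx0).
      apply Rminus_diag_eq in heq; unfold poly_in_y in heq.
      rewrite <- sum_n_minus in heq; rewrite <- heq.
      apply sum_n_ext; intros k.
      rewrite <- Rmult_minus_distr_r, <- sum_n_minus.
      f_equal; apply sum_n_ext; intros j; simpl; ring. }
    (* Back substitution from [i = n] downwards, with [m = n - i]: in equation [i] the terms with j
       < i vanish by triangularity and those with j > i by induction. *)
    assert (hdown : forall m i, (i + m = n)%nat -> c i = c' i).
    { induction m as [m IH] using (well_founded_induction Nat.lt_wf_0); intros i hi.
      assert (hs : sum_n (fun j => (c j - c' j) * w j i x0) n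
         = (c i - c' i) * w i i x0).
      { apply (sum_n_single (fun j => (c j - c' j) * w j i x0)); [lia|].
        intros j hj hne.
        destruct (Nat.lt_ge_cases j i).
        - rewrite htri by assumption; ring.
        - rewrite (IH (n - j)%nat) by lia; ring. }
      rewrite hd in hs by lia.
      symmetry in hs; apply Rmult_integral in hs.
      destruct hs as [hs|hs]; [lra|].
      now apply hdiag in hs; [|apply hA]. }
    intros i hi; apply (hdown (n - i)%nat); lia.
Qed.

(** * Regularity of the coefficients of the vector field *)

Lemma C1_on_strip_horizontal (D : R -> Prop) (f : R -> R -> R) (y : R) :
  C1_on_strip D f -> C1_over D (fun x => f x y).
Proof.
  intros hf x hx.
  destruct (hf x y hx) as [h1 [_ [h2 _]]]; split; [exact h1|].
  apply continuity_pt_filterlim.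
  intros eps heps.
  destruct (h2 (mkposreal eps heps)) as [d hd].
  exists d; split; [apply cond_pos|].
  intros t [_ ht].
  apply hd; [exact ht|].
  rewrite Rminus_diag, Rabs_R0; apply cond_pos.
Qed.

Lemma C1_over_linear (D : R -> Prop) (f g : R -> R) (a b : R) :
  open D -> C1_over D f -> C1_over D g ->
  C1_over D (fun x => a * f x + b * g x).
Proof.
  intros hD hf hg.
  apply (C1_over_of_is_derive D _ (fun x => a * Derive f x + b * Derive g x) hD).
  - intros x hx.
    apply (is_derive_plus (fun x => a * f x) (fun x => b * g x));
      apply is_derive_scal, Derive_correct; [apply hf|apply hg]; exact hx.
  - apply continuous_over_plus; apply continuous_over_mult;
      try apply continuous_over_const; intros x hx; [apply hf|apply hg]; exact hx.
Qed.

Lemma C1_over_ext (D : R -> Prop) (f g : R -> R) :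
  (forall x : R, f x = g x) -> C1_over D f -> C1_over D g.
Proof.
  intros h hf; replace g with f; [exact hf|].
  now apply functional_extensionality.
Qed.

Lemma C1_over_combination (D : R -> Prop) (c : nat -> R) (f : nat -> R -> R)
  (n : nat) :
  open D -> (forall j : nat, C1_over D (f j)) ->
  C1_over D (fun x => sum_n (fun j => c j * f j x) n).
Proof.
  intros hD hf; induction n as [|n IH].
  - apply (C1_over_ext D (fun x => c 0%nat * f 0%nat x + 0 * f 0%nat x)).
    + intros x; rewrite sum_O; ring.
    + now apply C1_over_linear.
  - apply (C1_over_ext D (fun x =>
      1 * sum_n (fun j => c j * f j x) n + c (S n) * f (S n) x)).
    + intros x; rewrite sum_n_R_S; ring.
    + now apply C1_over_linear.
Qed.

(** The coefficients are linear combinations of the restrictions of P to the lines y = 0 and y =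
    1. *)
Lemma fieldP_coefficients_C1 (D : R -> Prop) (p0 p1 : R -> R) :
  open D -> C1_on_strip D (fieldP p0 p1) -> C1_over D p0 /\ C1_over D p1.
Proof.
  intros hD hP.
  assert (h := fun y => C1_on_strip_horizontal D _ y hP).
  split.
  - apply (C1_over_ext D (fun x => fieldP p0 p1 x 0)); auto.
    intros x; unfold fieldP; ring.
  - apply (C1_over_ext D (fun x => 1 * fieldP p0 p1 x 1 + -1 * fieldP p0 p1 x 0)).
    + intros x; unfold fieldP; ring.
    + now apply C1_over_linear.
Qed.

(** Interpolation of a quadratic polynomial at y = -1, 0, 1. *)
Lemma fieldQ_coefficients_C1 (D : R -> Prop) (q0 q1 q2 : R -> R) :
  open D -> C1_on_strip D (fieldQ q0 q1 q2) ->
  C1_over D q0 /\ C1_over D q1 /\ C1_over D q2.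
Proof.
  intros hD hQ.
  assert (h := fun y => C1_on_strip_horizontal D _ y hQ).
  set (Q := fieldQ q0 q1 q2) in *.
  split; [|split].
  - apply (C1_over_ext D (fun x => Q x 0)); auto.
    intros x; unfold Q, fieldQ; ring.
  - apply (C1_over_ext D (fun x => (1 / 2) * Q x 1 + - (1 / 2) * Q x (-1))).
    + intros x; unfold Q, fieldQ; field.
    + now apply C1_over_linear.
  - apply (C1_over_ext D (fun x => 1 * (1 / 2 * Q x 1 + 1 / 2 * Q x (-1))
      + -1 * Q x 0)).
    + intros x; unfold Q, fieldQ; field.
    + apply C1_over_linear; auto.
      now apply C1_over_linear.
Qed.

(** * Expansion of M_{s,n} in powers of y *)

(* [v k], [dv k] stand for v_k(x), v_k'(x), and the divergence is [D0 + D1 * y].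
   The last two summands vanish when v_(n+1) = v_(n+2) = 0. *)
Lemma M_fun_telescope (s P0 P1 Q0 Q1 Q2 D0 D1 y : R) (v dv : nat -> R) (n : nat) :
  sum_n (fun k => dv k * y ^ k * (P0 + P1 * y)
      + v k * (INR k * y ^ pred k) * (Q0 + Q1 * y + Q2 * y ^ 2)
      + s * (v k * y ^ k) * (D0 + D1 * y)) n
  = P0 * dv 0%nat + s * D0 * v 0%nat + Q0 * v 1%nat
    + sum_n (fun k => y ^ S k * (P1 * dv k + (INR k * Q2 + s * D1) * v k
        + P0 * dv (S k) + (INR (S k) * Q1 + s * D0) * v (S k)
        + INR (S (S k)) * Q0 * v (S (S k)))) n
    - y ^ S n * (P0 * dv (S n) + (INR (S n) * Q1 + s * D0) * v (S n)
        + INR (S (S n)) * Q0 * v (S (S n)))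
    - INR (S n) * Q0 * v (S n) * y ^ n :> R.
Proof.
  induction n as [|n IH].
  - rewrite !sum_O; simpl; ring.
  - rewrite !sum_n_R_S, IH; cbn [pow pred].
    rewrite !S_INR; ring.
Qed.

(** Termwise differentiation, with divergence (p0' + q1) + (p1' + 2 q2) y, brings M to the single
    sum that [M_fun_telescope] regroups. *)
Lemma M_fun_poly_in_y (s : R) (p0 p1 q0 q1 q2 : R -> R) (n : nat)
  (v : nat -> R -> R) (x y : R) :
  ex_derive p0 x -> ex_derive p1 x -> (forall k : nat, ex_derive (v k) x) ->
  M_fun s (fieldP p0 p1) (fieldQ q0 q1 q2) (poly_in_y n v) x y
  = sum_n (fun k => Derive (v k) x * y ^ k * (p0 x + p1 x * y)
      + v k x * (INR k * y ^ pred k) * (q0 x + q1 x * y + q2 x * y ^ 2)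
      + s * (v k x * y ^ k)
        * ((Derive p0 x + q1 x) + (Derive p1 x + 2 * q2 x) * y)) n :> R.
Proof.
  intros hp0 hp1 hv.
  assert (dP : partial_x (fieldP p0 p1) x y = Derive p0 x + Derive p1 x * y).
  { unfold partial_x, fieldP.
    rewrite Derive_plus, Derive_scal_l; auto.
    exact (ex_derive_scal_l p1 x y hp1). }
  assert (dQ : partial_y (fieldQ q0 q1 q2) x y = q1 x + 2 * q2 x * y).
  { apply is_derive_unique; unfold fieldQ.
    auto_derive; auto; ring. }
  assert (dVx : partial_x (poly_in_y n v) x y
    = poly_in_y n (fun k => Derive (v k)) x y).
  { now apply is_derive_unique, is_derive_poly_in_y_x. }
  assert (dVy : partial_y (poly_in_y n v) x y
    = sum_n (fun k => v k x * (INR k * y ^ pred k)) n).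
  { apply is_derive_unique, is_derive_poly_in_y_y. }
  unfold M_fun, gradient, divergence, scalar_product; cbn [fst snd].
  rewrite dP, dQ, dVx, dVy; unfold poly_in_y, fieldP, fieldQ; clear.
  induction n as [|n IH].
  - rewrite !sum_O; ring.
  - rewrite !sum_n_R_S, <- IH; ring.
Qed.

(** * Assembly of the family *)

Theorem proposition2 (D : R -> Prop) (p0 p1 q0 q1 q2 : R -> R)
  (hD : open D)
  (hP : C1_on_strip D (fieldP p0 p1))
  (hQ : C1_on_strip D (fieldQ q0 q1 q2))
  (hp1 : exists x : R, D x /\ p1 x <> 0) :
  forall (s : R) (n : nat),
  exists v : (nat -> R) -> nat -> R -> R,
    parameter_family (nonvanishing D p1) n (fun c => poly_in_y n (v c)) /\
    forall c : nat -> R,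
      C1_on_strip (nonvanishing D p1) (poly_in_y n (v c)) /\
      only_x_on (nonvanishing D p1)
        (M_fun s (fieldP p0 p1) (fieldQ q0 q1 q2) (poly_in_y n (v c))).
Proof.
  intros s n.
  destruct (fieldP_coefficients_C1 D p0 p1 hD hP) as [cp0 cp1].
  destruct (fieldQ_coefficients_C1 D q0 q1 q2 hD hQ) as [cq0 [cq1 cq2]].
  set (E := nonvanishing D p1).
  assert (hE : open E).
  { intros x [hx hx1].
    apply filter_and; [now apply hD|].
    apply (C1_over_continuous D p1 cp1 x hx (fun z => z <> 0)).
    now apply open_neq. }
  assert (sub : forall f, C1_over D f -> C1_over E f).
  { intros f hf x hx; apply hf, hx. }
  apply sub in cp0; apply sub in cp1.
  apply sub in cq0; apply sub in cq1; apply sub in cq2.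
  assert (dp0 : continuous_over E (Derive p0)) by (intros x hx; now apply cp0).
  assert (dp1 : continuous_over E (Derive p1)) by (intros x hx; now apply cp1).
  (* The three functions in [hal], [hbe] and [hga] multiply v_k, v_(k+1) and v_(k+2) in the
     coefficient of y^(k+1) of M. *)
  assert (hal : forall k, continuous_over E
    (fun x => INR k * q2 x + s * (Derive p1 x + 2 * q2 x))).
  { auto 10 using continuous_over_plus, continuous_over_mult,
      continuous_over_const, C1_over_continuous. }
  assert (hbe : forall k, continuous_over E
    (fun x => INR (S k) * q1 x + s * (Derive p0 x + q1 x))).
  { auto 10 using continuous_over_plus, continuous_over_mult,
      continuous_over_const, C1_over_continuous. }
  assert (hga : forall k, continuous_over E (fun x => INR (S (S k)) * q0 x)).
  { auto using continuous_over_mult, continuous_over_const, C1_over_continuous. }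
  (* Choice gathers the solutions for all top degrees: [w j k] is the coefficient of y^k in W_j. *)
  destruct (choice _ (fun j => ladder_solution E p0 p1 _ _ _ j hE
    (C1_over_continuous _ _ cp0) (C1_over_continuous _ _ cp1)
    (fun x hx => proj2 hx) hal hbe hga)) as [w hw].
  clear hal hbe hga.
  exists (fun c k x => sum_n (fun j => c j * w j k x) n); split.
  - apply triangular_parameter_family.
    + intros j; apply hw.
    + intros j x _; apply hw.
  - intros c.
    set (v := fun k x => sum_n (fun j => c j * w j k x) n).
    assert (dw : forall j k x, E x -> ex_derive (w j k) x).
    { intros j k x hx; now apply hw. }
    assert (hdv : forall k x, E x ->
      is_derive (v k) x (sum_n (fun j => c j * Derive (w j k) x) n)).
    { intros k x hx.
      apply (is_derive_sum_n (fun j t => c j * w j k t)); intros j _.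
      now apply is_derive_scal, Derive_correct, dw. }
    assert (hv : forall k, C1_over E (v k)).
    { intros k; apply C1_over_combination; [exact hE|].
      intros j; apply hw. }
    split; [now apply poly_in_y_C1|].
    assert (htop : forall k x, (n < k)%nat -> v k x = 0).
    { intros k x hk.
      unfold v; rewrite (sum_n_ext_loc _ (fun _ => 0)).
      - rewrite sum_n_const; apply Rmult_0_r.
      - intros j hj; rewrite (proj1 (proj2 (hw j))) by lia; apply Rmult_0_r. }
    (* The coefficients above [n] are zero at every real, not only over [E], so the derivative
       vanishes everywhere too. *)
    assert (htop' : forall x, Derive (v (S n)) x = 0).
    { intros x; rewrite (Derive_ext _ (fun _ => 0)).
      - apply Derive_const.
      - intros t; apply htop; lia. }
    assert (hrec : forall k x, E x ->
      p1 x * Derive (v k) x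
      + (INR k * q2 x + s * (Derive p1 x + 2 * q2 x)) * v k x
      + p0 x * Derive (v (S k)) x
      + (INR (S k) * q1 x + s * (Derive p0 x + q1 x)) * v (S k) x
      + INR (S (S k)) * q0 x * v (S (S k)) x = 0).
    { intros k x hx.
      rewrite !(fun k => is_derive_unique _ _ _ (hdv k x hx)).
      unfold v; clear - hw hx.
      (* The recursion is linear: the equation of each W_j is multiplied by [c j], and the results
         are summed by induction on the number of terms. *)
      assert (hz := fun j => Rmult_eq_compat_l (c j) _ _
        (proj2 (proj2 (proj2 (hw j))) k x hx)).
      setoid_rewrite Rmult_0_r in hz.
      induction n as [|m IH].
      - rewrite !sum_O, <- (hz 0%nat); ring.
      - rewrite !sum_n_R_S, <- (Rplus_0_l 0).
        rewrite <- IH at 1; rewrite <- (hz (S m)); ring. }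
    (* The coefficient of y^0 in M, the only one that the recursion does not annihilate. *)
    exists (fun x => p0 x * Derive (v 0%nat) x
      + s * (Derive p0 x + q1 x) * v 0%nat x + q0 x * v 1%nat x).
    intros x y hx.
    rewrite M_fun_poly_in_y; [|now apply cp0|now apply cp1|intros k; now apply hv].
    rewrite (M_fun_telescope s (p0 x) (p1 x) (q0 x) (q1 x) (q2 x)
      (Derive p0 x + q1 x) (Derive p1 x + 2 * q2 x) y
      (fun k => v k x) (fun k => Derive (v k) x)).
    cbv beta; rewrite htop', (htop (S n)), (htop (S (S n))) by lia.
    rewrite (sum_n_ext _ (fun _ => 0)).
    + rewrite sum_n_const; ring.
    + intros k; rewrite hrec by assumption; apply Rmult_0_r.
Qed.
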